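(* Let $G=(V,E)$ be a finite connected simple undirected graph with $n=|V|$, let $u\neq v$ be vertices with $uv\notin E$, and let $s\in V$. For each nonempty $S\subseteq V\setminus\{s\}$, put $B=V\setminus S$, $K_S=(L[B,B])^{-1}$, and $$F_s(S)=e_{s,B}^{\mathsf T}K_Sa_B-\frac{\bigl(e_{s,B}^{\mathsf T}K_Sb_B\bigr)\bigl(b_B^{\mathsf T}K_S(d_B+a_B)\bigr)}{1+b_B^{\mathsf T}K_Sb_B}.$$ Then $$t_{\rm cov}(G+uv,s)-t_{\rm cov}(G,s)=\sum_{\varnothing\neq S\subseteq V\setminus\{s\}}(-1)^{|S|+1}F_s(S),$$ a sum with $2^{n-1}-1$ terms.
   Context: $t_{\rm cov}(G,s)$ is the expected first time at which simple random walk on $G$ started at $s$ has visited every vertex (the starting vertex is visited at time $0$). $G+uv$ is $G$ with the edge $uv$ added. $L=D-A$ is the graph Laplacian of $G$ ($D$ the diagonal degree matrix, $A$ the adjacency matrix), and $L[B,B]$ is its principal submatrix on rows and columns in $B$; it is invertible for every nonempty $S=V\setminus B$. $d\in\mathbb R^V$ is the vector of degrees in $G$, $e_x$ is the standard basis vector at $x$, $a=e_u+e_v$, $b=e_u-e_v$, and a subscript $B$ denotes restriction of a vector to the coordinates in $B$. *)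

(* Defs.v *)
From HB Require Import structures.
From mathcomp Require Import all_boot all_order all_algebra.
From mathcomp Require Import all_classical all_reals all_analysis.

Set Implicit Arguments.
Unset Strict Implicit.
Unset Printing Implicit Defensive.
Import Order.TTheory GRing.Theory Num.Theory.

Local Open Scope classical_set_scope.
Local Open Scope ring_scope.

(* A finite graph on V is an adjacency relation e : rel V; simplicity is
   symmetry and irreflexivity of e. *)
Definition add_edge (V : finType) (e : rel V) (u v : V) : rel V :=
  [rel x y | [|| e x y, (x == u) && (y == v) | (x == v) && (y == u)]].

Definition connected_graph (V : finType) (e : rel V) : Prop :=
  forall x y : V, connect e x y.

Definition degree (V : finType) (e : rel V) (x : V) : nat := #|e x|.

Definition step_prob (R : realType) (V : finType) (e : rel V) (x y : V) : R :=
  (e x y)%:R / (degree e x)%:R.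

(* X is a simple random walk started at s.  The conditional law of X_(k+1)
   given X_0, ..., X_k is multiplied out, so that no conditioning on null
   events occurs. *)
Record simple_random_walk (R : realType) (d : measure_display)
    (Omega : measurableType d) (P : probability Omega R)
    (V : finType) (e : rel V) (s : V) (X : nat -> Omega -> V) : Prop := {
  srw_measurable : forall (k : nat) (x : V), measurable [set w | X k w = x];
  srw_start : P [set w | X 0%N w = s] = 1%E;
  srw_step : forall (k : nat) (x : nat -> V),
    P [set w | forall i, (i <= k.+1)%N -> X i w = x i] =
    (P [set w | forall i, (i <= k)%N -> X i w = x i]
       * (step_prob R e (x k) (x k.+1))%:E)%E
}.

(* The value is +oo when some vertex is never visited. *)
Definition cover_time (R : realType) (Omega : Type) (V : finType)
    (X : nat -> Omega -> V) (w : Omega) : \bar R :=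
  ereal_inf [set (t%:R)%:E | t in
    [set t : nat | forall x : V, exists2 k, (k <= t)%N & X k w = x]].

Definition expected_cover_time (R : realType) (d : measure_display)
    (Omega : measurableType d) (P : probability Omega R)
    (V : finType) (X : nat -> Omega -> V) : \bar R :=
  (\int[P]_w cover_time R X w)%E.

(* Vectors in R^V and V x V matrices are indexed by 'I_#|V| through the
   bijection enum_val : 'I_#|V| -> V, with inverse enum_rank. *)
Definition adjacency_mx (R : realType) (V : finType) (e : rel V) :
    'M[R]_#|V| :=
  \matrix_(i, j) (e (enum_val i) (enum_val j))%:R.

Definition degree_vec (R : realType) (V : finType) (e : rel V) :
    'cV[R]_#|V| :=
  \col_i (degree e (enum_val i))%:R.

Definition laplacian (R : realType) (V : finType) (e : rel V) : 'M[R]_#|V| :=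
  diag_mx (degree_vec R e)^T - adjacency_mx R e.

Definition basis_vec (R : realType) (V : finType) (x : V) : 'cV[R]_#|V| :=
  delta_mx (enum_rank x) 0.

Definition sub_index (V : finType) (B : {set V}) (i : 'I_#|B|) : 'I_#|V| :=
  enum_rank (enum_val i).

Definition principal_submx (R : realType) (V : finType) (B : {set V})
    (M : 'M[R]_#|V|) : 'M[R]_#|B| :=
  mxsub (@sub_index V B) (@sub_index V B) M.

Definition restrict_vec (R : realType) (V : finType) (B : {set V})
    (x : 'cV[R]_#|V|) : 'cV[R]_#|B| :=
  rowsub (@sub_index V B) x.

Definition bilin (R : realType) (m : nat) (x : 'cV[R]_m) (M : 'M[R]_m)
    (y : 'cV[R]_m) : R :=
  (x^T *m M *m y) 0 0.

Definition F_term (R : realType) (V : finType) (e : rel V) (u v s : V)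
    (S : {set V}) : R :=
  let B := (~: S)%SET in
  let K := invmx (principal_submx B (laplacian R e)) in
  let es := restrict_vec B (basis_vec R s) in
  let a := restrict_vec B (basis_vec R u + basis_vec R v) in
  let b := restrict_vec B (basis_vec R u - basis_vec R v) in
  let dB := restrict_vec B (degree_vec R e) in
  bilin es K a
    - bilin es K b * bilin b K (dB + a) / (1 + bilin b K b).

Definition nonempty_subsets_avoiding (V : finType) (s : V) :
    {set {set V}} :=
  [set S : {set V} | (S != finset.set0) && (S \subset [set~ s])]%SET.

(* Main.v *)
(* Let U_t be the set of vertices not visited by time t.  Then
   E[t_cov] = sum_t P(U_t != set0), and inclusion-exclusion gives
   P(U_t != set0) = sum_(S != set0) (-1)^(|S|+1) P(S subset U_t), where
   S subset U_t means that the walk stays in B = ~: S up to time t.  Summed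
   over t, these probabilities give the expected exit time h(s) from B, and
   L[B,B] h = d_B.  Adding the edge uv changes L[B,B] by the rank-one term
   b b^T and d by a, so the Sherman-Morrison formula gives
   F_s(S) = h'(s) - h(s). *)

Require Import Defs.
From HB Require Import structures.
From mathcomp Require Import all_boot all_order all_algebra.
From mathcomp Require Import all_classical all_reals all_analysis.
From mathcomp Require Import ring.

Set Implicit Arguments.
Unset Strict Implicit.
Unset Printing Implicit Defensive.
Import Order.TTheory GRing.Theory Num.Theory.
Import numFieldNormedType.Exports.

Local Open Scope ring_scope.

(** * Graph hypotheses inherited by the graph with the added edge *)

Lemma add_edge_sym (V : finType) (e : rel V) (u v : V) :
  symmetric e -> symmetric (add_edge e u v).
Proof.
move=> e_sym x y; rewrite /add_edge /= e_sym; congr (_ || _).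
by rewrite orbC [(x == v) && _]andbC [(x == u) && _]andbC.
Qed.

Lemma add_edge_connected (V : finType) (e : rel V) (u v : V) :
  connected_graph e -> connected_graph (add_edge e u v).
Proof.
move=> e_conn x y; apply: connect_sub (e_conn x y) => {}x {}y exy.
by apply: connect1; rewrite /add_edge /= exy.
Qed.

(** * The restricted Laplacian, exit times and survival probabilities *)

Section Graph.
Variables (R : realType) (V : finType) (e : rel V).

Lemma natr_degree (x : V) : (degree e x)%:R = \sum_z (e x z)%:R :> R.
Proof.
rewrite /degree -sum1_card natr_sum big_mkcond; apply: eq_bigr => z _.
by rewrite unfold_in; case: (e x z).
Qed.

Lemma connected_degree_gt0 (x y : V) :
  connected_graph e -> x != y -> (0 < degree e x)%N.
Proof.
move=> e_conn; case/connectP: (e_conn x y) => -[|z p] /=.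
  by move=> _ ->; rewrite eqxx.
by case/andP=> exz _ _ _; apply/card_gt0P; exists z.
Qed.

(* Summation by parts turns [f * L f = 0] into the vanishing of the Dirichlet
   energy of [f]. *)
Lemma dirichlet_unique (B : {set V}) (x0 : V) (f : V -> R) :
  symmetric e -> connected_graph e -> x0 \notin B ->
  (forall x, x \notin B -> f x = 0) ->
  (forall x, x \in B -> \sum_z (e x z)%:R * (f x - f z) = 0) ->
  forall x, f x = 0.
Proof.
move=> e_sym e_conn x0B f0 fL x.
pose E := \sum_x \sum_z (e x z)%:R * (f x * (f x - f z)).
have E0 : E = 0.
  rewrite /E big1 // => y _.
  have [yB|yB] := boolP (y \in B); last first.
    by rewrite big1 // => z _; rewrite (f0 y) // mul0r mulr0.
  transitivity (f y * \sum_z (e y z)%:R * (f y - f z)).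
    by rewrite mulr_sumr; apply: eq_bigr => z _; rewrite mulrCA.
  by rewrite fL // mulr0.
have EE : \sum_x \sum_z (e x z)%:R * (f x - f z) ^+ 2 = 0.
  transitivity (E + E); last by rewrite E0 addr0.
  rewrite {2}/E [X in _ + X]exchange_big /E -big_split /=.
  apply: eq_bigr => y _; rewrite -big_split /=; apply: eq_bigr => z _.
  by rewrite (e_sym z y); ring.
have fE y z : e y z -> f y = f z.
  move=> eyz; apply/eqP; rewrite -subr_eq0 -sqrf_eq0.
  have ge0 a c : 0 <= (e a c)%:R * (f a - f c) ^+ 2.
    by rewrite mulr_ge0 ?ler0n ?sqr_ge0.
  move/eqP: EE; rewrite psumr_eq0; last by move=> *; apply: sumr_ge0.
  move/allP/(_ y (mem_index_enum _)) => /=.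
  rewrite psumr_eq0; last by move=> *.
  by move/allP/(_ z (mem_index_enum _)); rewrite eyz mul1r.
have path_f p y : path e y p -> f (last y p) = f y.
  by elim: p y => //= z p IH y /andP[/fE -> /IH].
by case/connectP: (e_conn x0 x) => p /path_f + -> => ->; apply: f0.
Qed.

(** Extension by zero from [B] to [V]. Summing over all indices avoids having to choose an index for
    [y], which does not exist when [y] lies outside [B]. *)
Definition extend_vec (B : {set V}) (x : 'cV[R]_#|B|) (y : V) : R :=
  \sum_(i < #|B|) x i 0 * (enum_val i == y)%:R.

Lemma extend_vec_enum_val (B : {set V}) (x : 'cV[R]_#|B|) i :
  extend_vec x (enum_val i) = x i 0.
Proof.
rewrite /extend_vec (bigD1 i) //= eqxx mulr1 big1 ?addr0 // => j ji.
by rewrite (inj_eq enum_val_inj) (negPf ji) mulr0.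
Qed.

Lemma extend_vec_out (B : {set V}) (x : 'cV[R]_#|B|) y : y \notin B -> extend_vec x y = 0.
Proof.
move=> yB; rewrite /extend_vec big1 // => i _.
case: eqP => [iy|]; last by rewrite mulr0.
by rewrite -iy enum_valP in yB.
Qed.

Lemma sub_index_inj (B : {set V}) : injective (@sub_index V B).
Proof. by move=> i j /enum_rank_inj/enum_val_inj. Qed.

(** The diagonal entry counts all neighbours, including those outside [B]; at these the extension is
    zero, so every neighbour contributes a difference. This is the form that [dirichlet_unique]
    expects. *)
Lemma principal_laplacian_mulE (B : {set V}) (x : 'cV[R]_#|B|) i :
  (principal_submx B (laplacian R e) *m x) i 0 =
  \sum_z (e (enum_val i) z)%:R *
    (extend_vec x (enum_val i) - extend_vec x z).
Proof.
under [RHS]eq_bigr do rewrite mulrBr.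
rewrite sumrB -mulr_suml -natr_degree extend_vec_enum_val mxE.
under eq_bigr => j _.
  rewrite !mxE /sub_index !enum_rankK (inj_eq enum_rank_inj).
  rewrite (inj_eq enum_val_inj) mulrBl.
  over.
rewrite sumrB; congr (_ - _).
  rewrite (bigD1 i) //= eqxx big1 ?addr0 // => j ji.
  by rewrite eq_sym (negPf ji) mul0r.
under [RHS]eq_bigr do rewrite /extend_vec mulr_sumr.
rewrite exchange_big /=; apply: eq_bigr => j _.
rewrite (bigD1 (enum_val j)) //= eqxx mulr1 big1 ?addr0 // => z zj.
by rewrite eq_sym (negPf zj) !mulr0.
Qed.

(** A kernel vector, extended by zero, satisfies the hypotheses of [dirichlet_unique] and hence
    vanishes. *)
Lemma principal_laplacian_unit (B : {set V}) (x0 : V) :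
  symmetric e -> connected_graph e -> x0 \notin B ->
  principal_submx B (laplacian R e) \in unitmx.
Proof.
move=> e_sym e_conn x0B; rewrite -unitmx_tr -row_free_unit.
apply: inj_row_free => w wL.
have Lw : principal_submx B (laplacian R e) *m w^T = 0.
  by apply: trmx_inj; rewrite trmx_mul trmxK wL trmx0.
apply: trmx_inj; rewrite trmx0; apply/matrixP => i j; rewrite (ord1 j).
rewrite -extend_vec_enum_val [RHS]mxE.
apply: dirichlet_unique e_sym e_conn x0B _ _ _ => [x|x xB].
  exact: extend_vec_out.
rewrite -(enum_rankK_in xB xB) -principal_laplacian_mulE Lw.
by rewrite mxE.
Qed.

(** The candidate for the expected exit times is introduced by linear algebra alone;
    [survival_series_cvg] links it to survival probabilities. *)
Definition hitting_vec (B : {set V}) : 'cV[R]_#|B| :=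
  invmx (principal_submx B (laplacian R e)) *m restrict_vec B (degree_vec R e).

Definition exit_time (B : {set V}) (x : V) : R := extend_vec (hitting_vec B) x.

(** Transition operator of the walk killed outside [B]. *)
Definition killed_step (B : {set V}) (f : V -> R) (x : V) : R :=
  (x \in B)%:R * \sum_z step_prob R e x z * f z.

(** First-step analysis: on [B] this is a row of $L[B,B]h=d_B$ divided by the degree, which is
    nonzero because the graph is connected and [x] differs from [x0]. *)
Lemma exit_time_harmonic (B : {set V}) (x0 : V) :
  symmetric e -> connected_graph e -> x0 \notin B ->
  forall x, exit_time B x = (x \in B)%:R + killed_step B (exit_time B) x.
Proof.
move=> e_sym e_conn x0B x; rewrite /killed_step.
have [xB|xB] := boolP (x \in B); last first.
  by rewrite mul0r addr0; exact: extend_vec_out.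
rewrite mul1r; set d : R := (degree e x)%:R.
have d0 : d != 0.
  rewrite pnatr_eq0 -lt0n; apply: (@connected_degree_gt0 x x0) => //.
  by apply: contraNneq x0B => <-.
have LK : principal_submx B (laplacian R e) *m hitting_vec B =
    restrict_vec B (degree_vec R e).
  by rewrite mulKVmx // (principal_laplacian_unit _ _ x0B).
have := congr1 (fun w : 'cV_#|B| => w (enum_rank_in xB x) 0) LK.
rewrite principal_laplacian_mulE !mxE /sub_index (enum_rankK_in xB xB) enum_rankK.
rewrite -/(exit_time B x) -/d.
under eq_bigr => z _ do rewrite mulrBr -/(exit_time B z).
rewrite sumrB -mulr_suml -natr_degree -/d => /eqP; rewrite subr_eq => /eqP Hd.
apply: (mulfI d0); rewrite Hd mulrDr mulr1 mulr_sumr; congr (_ + _).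
apply: eq_bigr => z _; rewrite /step_prob -/d mulrA; congr (_ * _).
by rewrite mulrC mulfVK.
Qed.

Lemma bilin_exit_time (B : {set V}) (s : V) : s \in B ->
  bilin (restrict_vec B (basis_vec R s))
    (invmx (principal_submx B (laplacian R e)))
    (restrict_vec B (degree_vec R e)) = exit_time B s.
Proof.
move=> sB; rewrite /bilin -mulmxA -/(hitting_vec B) mxE.
rewrite /exit_time /extend_vec; apply: eq_bigr => i _.
by rewrite mulrC !mxE andbT /sub_index (inj_eq enum_rank_inj).
Qed.

Lemma killed_step_sum (B : {set V}) n (F : nat -> V -> R) x :
  killed_step B (fun y => \sum_(i < n) F i y) x =
  \sum_(i < n) killed_step B (F i) x.
Proof.
rewrite /killed_step -mulr_sumr; congr (_ * _).
rewrite exchange_big; apply: eq_bigr => z _.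
by rewrite mulr_sumr.
Qed.

(** The operator is linear with nonnegative coefficients, so domination is preserved; this is the
    induction step for the remainder bound in [survival_series_cvg]. *)
Lemma killed_step_norm (B : {set V}) (f g : V -> R) (c : R) :
  (forall x, `|f x| <= c * g x) ->
  forall x, `|killed_step B f x| <= c * killed_step B g x.
Proof.
move=> fg x; rewrite /killed_step normrM mulrCA ger0_norm //.
apply: ler_wpM2l => //; rewrite mulr_sumr.
apply: le_trans (ler_norm_sum _ _ _) _; apply: ler_sum => z _.
have p0 : 0 <= step_prob R e x z by rewrite divr_ge0.
by rewrite normrM ger0_norm // mulrCA ler_wpM2l.
Qed.

(* [survival B t x] is the probability that the walk started at [x] stays in
   [B] up to time [t]. *)
Definition survival (B : {set V}) (t : nat) : V -> R :=
  iter t (killed_step B) (fun x => (x \in B)%:R).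

Lemma survival_ge0 (B : {set V}) t x : 0 <= survival B t x.
Proof.
elim: t x => [|t IH] x; first exact: ler0n.
rewrite mulr_ge0 // sumr_ge0 // => z _.
by rewrite mulr_ge0 // divr_ge0.
Qed.

Lemma survival_le1 (B : {set V}) t x : survival B t x <= 1.
Proof.
elim: t x => [|t IH] x; first by rewrite lern1 leq_b1.
rewrite /survival iterS -/(survival B t) /killed_step mulr_ile1 //.
- by rewrite sumr_ge0 // => z _; rewrite mulr_ge0 ?survival_ge0 // divr_ge0.
- by rewrite lern1 leq_b1.
(* At an isolated vertex the inverse of 0 is 0, so the transition probabilities sum to 0 instead of
   1. *)
have [d0|d0] := eqVneq (degree e x) 0%N.
  by rewrite big1 // => z _; rewrite /step_prob d0 invr0 mulr0 mul0r.
apply: (@le_trans _ _ (\sum_z step_prob R e x z)).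
  by apply: ler_sum => z _; rewrite ler_piMr // divr_ge0.
by rewrite -mulr_suml -natr_degree mulfV // pnatr_eq0.
Qed.

(* The remainder [h - sum_(i < t) q_i] is the [t]-th iterate of the killed
   operator on [h], hence at most [C * q_t]; the partial sums are therefore
   bounded, so [q_t] tends to [0], and so does the remainder. *)
Lemma survival_series_cvg (B : {set V}) (x0 : V) :
  symmetric e -> connected_graph e -> x0 \notin B ->
  forall x, (\sum_(0 <= t < n) survival B t x @[n --> \oo] -->
    (exit_time B x : R))%classic.
Proof.
move=> e_sym e_conn x0B x.
pose h := exit_time B.
pose r n y := h y - \sum_(i < n) survival B i y.
have rS n y : r n.+1 y = killed_step B (r n) y.
  rewrite {1}/r {1}/h (exit_time_harmonic e_sym e_conn x0B y) big_ord_recl.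
  rewrite opprD addrACA subrr add0r -killed_step_sum /killed_step -mulrBr.
  by rewrite -sumrB; congr (_ * _); apply: eq_bigr => z _; rewrite mulrBr.
pose C := \sum_y `|h y|.
have r_le n y : `|r n y| <= C * survival B n y.
  elim: n y => [|n IH] y; last by rewrite rS; apply: killed_step_norm.
  rewrite /r big_ord0 subr0 /survival /=.
  have [yB|yB] := boolP (y \in B).
    by rewrite mulr1 /C (bigD1 y) //= lerDl sumr_ge0.
  by rewrite mulr0 /h /exit_time extend_vec_out // normr0.
have C0 : 0 <= C by rewrite sumr_ge0.
have sums_bounded n : \sum_(0 <= t < n) survival B t x <= C + C.
  rewrite big_mkord -[leLHS](subKr (h x)) -/(r n x).
  apply: le_trans (ler_norm _) _; apply: le_trans (ler_normB _ _) _.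
  apply: lerD; first by rewrite /C (bigD1 x) //= lerDl sumr_ge0.
  by apply: le_trans (r_le n x) _; rewrite ler_piMr // survival_le1.
have q0 : (survival B n x @[n --> \oo] --> (0 : R))%classic.
  apply: cvg_series_cvg_0; apply: nondecreasing_is_cvgn.
    apply/nondecreasing_seqP => n; rewrite /series /= big_nat_recr //=.
    by rewrite lerDl survival_ge0.
  by exists (C + C) => _ [n _ <-]; exact: sums_bounded.
have rn0 : (r n x @[n --> \oo] --> (0 : R))%classic.
  apply/norm_cvg0P.
  apply: (@squeeze_cvgr _ _ _ _ (fun=> 0) (fun n => C * survival B n x)).
  - by apply: nearW => n; rewrite normr_ge0 r_le.
  - exact: cvg_cst.
  - by rewrite -[X in (_ --> X)%classic](mulr0 C); apply: cvgMr.
suff : ((h x - r n x) @[n --> \oo] --> h x - 0)%classic.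
  rewrite subr0; under eq_fun => n.
    rewrite /r subKr -(big_mkord xpredT (fun i => survival B i x)).
    over.
  by [].
by apply: cvgB => //; apply: cvg_cst.
Qed.

End Graph.

(** * The rank-one update caused by the new edge *)

(** The solution $z$ of $(M+bb^T)z=w$ satisfies $z=Kw-\beta Kb$ with $\beta=b^Tz$. Pairing this with
    $b$ gives a scalar equation for $\beta$; pairing it with $y$ gives the formula. *)
Lemma sherman_morrison_bilin (R : realType) n (M : 'M[R]_n)
    (b y w : 'cV[R]_n) :
  M \in unitmx -> M + b *m b^T \in unitmx ->
  bilin y (invmx (M + b *m b^T)) w =
  bilin y (invmx M) w - bilin y (invmx M) b * bilin b (invmx M) w
    / (1 + bilin b (invmx M) b).
Proof.
move=> Mu M'u; set K := invmx M; set K' := invmx _.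
(* If the denominator vanished, $M+bb^T$ would annihilate $Kb$; then $Kb=0$, and the denominator
   would be 1. *)
have nz : 1 + bilin b K b != 0.
  apply/eqP => H.
  have : (M + b *m b^T) *m (K *m b) = 0.
    rewrite mulmxDl mulKVmx // -mulmxA (mulmxA b^T) (mx11_scalar (b^T *m K *m b)).
    by rewrite -/(bilin b K b) mul_mx_scalar -{1}[b]scale1r -scalerDl H scale0r.
  move/(congr1 (mulmx K')); rewrite mulKmx // mulmx0 => Kb0.
  by move: H; rewrite /bilin -mulmxA Kb0 mulmx0 mxE addr0 => /eqP; rewrite oner_eq0.
pose z := K' *m w; pose beta := (b^T *m z) 0 0.
have zE : z = K *m w - beta *: (K *m b).
  have : (M + b *m b^T) *m z = w by rewrite mulKVmx.
  rewrite mulmxDl -mulmxA (mx11_scalar (b^T *m z)) -/beta mul_mx_scalar.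
  move/eqP; rewrite -[X in _ == X](subrK (beta *: b)) (inj_eq (addIr _)) => /eqP.
  move/(congr1 (mulmx K)); rewrite mulKmx // mulmxBr -scalemxAr => zE; exact: zE.
have bilinE p : (p^T *m z) 0 0 = bilin p K w - beta * bilin p K b.
  rewrite zE mulmxBr -scalemxAr !mulmxA [LHS]mxE [X in _ + X]mxE.
  by rewrite [X in - X]mxE.
have betaE : beta = bilin b K w / (1 + bilin b K b).
  apply: (canRL (mulfK nz)).
  by rewrite mulrDr mulr1 {1}/beta bilinE subrK.
by rewrite {1}/bilin -mulmxA -/z bilinE betaE; congr (_ - _); rewrite mulrC mulrA.
Qed.

(** The disjunction becomes a sum because its three cases exclude each other: [u] and [v] are
    distinct and not adjacent. *)
Lemma add_edgeE (R : realType) (V : finType) (e : rel V) (u v x y : V) :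
  u != v -> symmetric e -> ~~ e u v ->
  (add_edge e u v x y)%:R = (e x y)%:R + ((x == u) && (y == v))%:R
    + ((x == v) && (y == u))%:R :> R.
Proof.
move=> uv e_sym nuv; rewrite /add_edge /=.
have nvu : ~~ e v u by rewrite e_sym.
have [->|xu] := eqVneq x u; rewrite /= ?(negPf uv) ?andFb ?orbF ?addr0.
  by have [->|yv] := eqVneq y v; rewrite ?(negPf nuv) /= ?orbF ?orbT ?add0r ?addr0.
have [->|xv] := eqVneq x v; rewrite /= ?orbF ?addr0 //.
by have [->|yu] := eqVneq y u; rewrite ?(negPf nvu) /= ?orbF ?orbT ?add0r ?addr0.
Qed.

Lemma degree_vec_add_edge (R : realType) (V : finType) (e : rel V) (u v : V) :
  u != v -> symmetric e -> ~~ e u v ->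
  degree_vec R (add_edge e u v) =
    degree_vec R e + (basis_vec R u + basis_vec R v).
Proof.
move=> uv e_sym nuv; apply/matrixP => i j; rewrite (ord1 j) !mxE !andbT !natr_degree.
under eq_bigr do rewrite add_edgeE //.
rewrite !big_split /= -addrA; congr (_ + _).
have pick (a c : V) :
    \sum_z ((enum_val i == a) && (z == c))%:R = (i == enum_rank a)%:R :> R.
  rewrite (bigD1 c) //= eqxx andbT big1 ?addr0; last first.
    by move=> z /negPf ->; rewrite andbF.
  by rewrite (can2_eq (@enum_valK V) (@enum_rankK V)).
by rewrite !pick.
Qed.

(** The squares in $bb^T$ account for the two new degrees, the cross terms for the two new adjacency
    entries. *)
Lemma laplacian_add_edge (R : realType) (V : finType) (e : rel V) (u v : V) :
  u != v -> symmetric e -> ~~ e u v ->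
  laplacian R (add_edge e u v) = laplacian R e
    + (basis_vec R u - basis_vec R v) *m (basis_vec R u - basis_vec R v)^T.
Proof.
move=> uv e_sym nuv; rewrite /laplacian degree_vec_add_edge //.
apply/matrixP => i j; rewrite !mxE big_ord_recl big_ord0 addr0 !mxE !andbT.
rewrite add_edgeE // !(can2_eq (@enum_valK V) (@enum_rankK V)).
have ruv : enum_rank u != enum_rank v by rewrite (inj_eq enum_rank_inj).
have := eqVneq i j; move: ruv; move: (enum_rank u) (enum_rank v) => p q pq.
case=> [<-|ij]; rewrite ?mulr1n ?mulr0n.
  have [->|ip] := eqVneq i p; first by rewrite (negPf pq) /=; ring.
  by case: (i == q) => /=; ring.
have [ip|ip] := eqVneq i p.
  have jp : j == p = false by rewrite -ip eq_sym (negPf ij).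
  by rewrite ip jp (negPf pq); case: (j == q) => /=; ring.
have [iq|iq] := eqVneq i q; last by rewrite /=; ring.
have jq : j == q = false by rewrite -iq eq_sym (negPf ij).
by rewrite jq; case: (j == p) => /=; ring.
Qed.

Lemma principal_submx_add_edge (R : realType) (V : finType) (e : rel V)
    (u v : V) (B : {set V}) :
  u != v -> symmetric e -> ~~ e u v ->
  let b := restrict_vec B (basis_vec R u - basis_vec R v) in
  principal_submx B (laplacian R (add_edge e u v)) =
  principal_submx B (laplacian R e) + b *m b^T.
Proof.
move=> uv e_sym nuv /=; rewrite laplacian_add_edge //.
apply/matrixP => i j; rewrite [LHS]mxE [LHS]mxE [RHS]mxE; congr (_ + _).
  by rewrite [RHS]mxE.
by rewrite !mxE; apply: eq_bigr => k _; rewrite !mxE.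
Qed.

(** Sherman-Morrison is applied with right-hand side $d_B+a_B$. In its leading term the $d_B$ part
    is the old exit time and cancels, leaving the $a_B$ part. *)
Lemma F_term_exit_time (R : realType) (V : finType) (e : rel V) (u v s : V)
    (S : {set V}) :
  symmetric e -> connected_graph e -> u != v -> ~~ e u v ->
  S \in nonempty_subsets_avoiding s ->
  F_term R e u v s S = exit_time R (add_edge e u v) (~: S)%SET s
    - exit_time R e (~: S)%SET s.
Proof.
move=> e_sym e_conn uv nuv; rewrite inE => /andP[/set0Pn[x0 x0S] Ss].
have sB : s \in (~: S)%SET.
  by rewrite inE; apply/negP => /(fintype.subsetP Ss); rewrite !inE eqxx.
have x0B : x0 \notin (~: S)%SET by rewrite inE x0S.
rewrite -!bilin_exit_time // /F_term principal_submx_add_edge //.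
rewrite degree_vec_add_edge //.
have restrictD (x y : 'cV[R]_#|V|) : restrict_vec (~: S)%SET (x + y) =
    restrict_vec (~: S)%SET x + restrict_vec (~: S)%SET y.
  by apply/matrixP => i j; rewrite !mxE.
rewrite [restrict_vec _ (degree_vec _ _ + _)]restrictD sherman_morrison_bilin.
- rewrite [bilin _ _ (_ + _) in RHS]/bilin mulmxDr [X in _ = X - _ - _]mxE.
  by rewrite -!/(bilin _ _ _); ring.
- exact: principal_laplacian_unit e_sym e_conn x0B.
- rewrite -principal_submx_add_edge //.
  apply: principal_laplacian_unit x0B; first exact: add_edge_sym.
  exact: add_edge_connected.
Qed.

(** * Inclusion-exclusion, for sets and for random sets *)

(** For [x] in [U], toggling membership of [x] is an involution that keeps [S \subset U] and flips
    the sign. The sum over all [S] is therefore 0, and its empty-set term is -1. *)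
Lemma sum_sign_subsets (R : realType) (V : finType) (U : {set V}) :
  \sum_(S : {set V} | S != finset.set0)
    (-1) ^+ #|S|.+1 * (S \subset U)%:R = (U != finset.set0)%:R :> R.
Proof.
have [->|/set0Pn[x xU]] := eqVneq U finset.set0.
  rewrite big1 // => S S0.
  by rewrite finset.subset0 (negPf S0) mulr0.
pose h (S : {set V}) := if x \in S then (S :\ x)%SET else (x |: S)%SET.
have hK : involutive h.
  move=> S; rewrite /h; have [xS|xS] := boolP (x \in S).
    by rewrite !inE eqxx /= finset.setD1K.
  by rewrite !inE eqxx /= finset.setU1K.
have hU S : (h S \subset U) = (S \subset U).
  rewrite /h; case: ifP => xS; last by rewrite finset.subUset finset.sub1set xU.
  by rewrite -{2}(finset.setD1K xS) finset.subUset finset.sub1set xU.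
have h_sign S : (-1) ^+ #|h S| = - (-1) ^+ #|S| :> R.
  rewrite /h; case: ifP => xS; last by rewrite cardsU1 xS exprS mulN1r.
  by rewrite [in RHS](cardsD1 x S) xS exprS mulN1r opprK.
pose f (S : {set V}) : R := (-1) ^+ #|S|.+1 * (S \subset U)%:R.
have f0 : \sum_S f S = 0.
  have : \sum_S f S + \sum_S f S = 0.
    rewrite {2}(reindex_inj (inv_inj hK)) -big_split big1 //= => S _.
    by rewrite /f hU !exprS h_sign; ring.
  by move/eqP; rewrite -mulr2n mulrn_eq0 => /eqP.
move/eqP: f0; rewrite (bigD1 finset.set0) //= {1}/f cards0 finset.sub0set mulr1 expr1.
by rewrite addrC subr_eq0 => /eqP.
Qed.

Section Probability.
Variables (R : realType) (d : measure_display) (Omega : measurableType d).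
Variable P : probability Omega R.

(** Probabilities are finite, so signed sums of them can be handled in [R] through [fine]. *)
Lemma probability_EFin (A : set Omega) : measurable A -> P A = (fine (P A))%:E.
Proof. by move=> mA; rewrite fineK // fin_num_measure. Qed.

Lemma fine_probability_partition (I : finType) (Y : Omega -> I) (A : set Omega) :
  measurable A -> (forall i, measurable [set w | Y w = i]%classic) ->
  fine (P A) = \sum_i fine (P (A `&` [set w | Y w = i])%classic).
Proof.
move=> mA mY; apply: EFin_inj.
have mAY i : measurable (A `&` [set w | Y w = i])%classic by exact: measurableI.
rewrite -sumEFin -probability_EFin //; under eq_bigr do rewrite -probability_EFin //.
have AE : A = (\bigcup_i (A `&` [set w | Y w = i]))%classic.
  by apply/seteqP; split=> w => [Aw|[i _ []]//]; exists (Y w).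
rewrite {1}AE measure_fin_bigcup //.
- rewrite (fsbigE (enum I)) ?enum_uniq //; last first.
    by move=> i _; rewrite mem_enum.
  by rewrite big_enum_cond /=; apply: eq_bigl => i; rewrite in_setT.
- exact: finite_finset.
- by move=> i j _ _ [w [[_ <-] [_ <-]]].
Qed.

Lemma fine_probability_preimage (I : finType) (Y : Omega -> I) (Q : pred I) :
  (forall i, measurable [set w | Y w = i]%classic) ->
  fine (P [set w | Q (Y w)]%classic) =
  \sum_i (Q i)%:R * fine (P [set w | Y w = i]%classic).
Proof.
move=> mY.
have mQ : measurable [set w | Q (Y w)]%classic.
  have -> : ([set w | Q (Y w)] = \bigcup_(i in [set i | Q i]) [set w | Y w = i])%classic.
    by apply/seteqP; split=> w /= => [Qw|[i Qi ->]//]; exists (Y w).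
  by apply: fin_bigcup_measurable => //; exact: finite_finset.
rewrite (fine_probability_partition mQ mY); apply: eq_bigr => i _.
have [Qi|Qi] := boolP (Q i).
  rewrite mul1r; congr (fine (P _)); apply/seteqP; split=> w /=; first by case.
  by move=> Yw; rewrite Yw.
rewrite mul0r (_ : (_ `&` _)%classic = set0) ?measure0 //.
by apply/seteqP; split=> w //= [+ Yw]; rewrite Yw (negPf Qi).
Qed.

(** Both sides are expanded over the finitely many values [A] of [U]; the coefficients of each [A]
    agree by [sum_sign_subsets]. *)
Lemma probability_nonempty (V : finType) (U : Omega -> {set V}) :
  (forall S, measurable [set w | U w = S]%classic) ->
  fine (P [set w | U w != finset.set0]%classic) =
  \sum_(S : {set V} | S != finset.set0)
    (-1) ^+ #|S|.+1 * fine (P [set w | S \subset U w]%classic).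
Proof.
move=> mU; rewrite (fine_probability_preimage (fun A : {set V} => A != finset.set0) mU).
under [RHS]eq_bigr => S _.
  rewrite (fine_probability_preimage (fun A : {set V} => S \subset A) mU) mulr_sumr.
  under eq_bigr do rewrite mulrA.
  over.
rewrite exchange_big /=; apply: eq_bigr => A _.
by rewrite -mulr_suml sum_sign_subsets.
Qed.

End Probability.

(** * The law of the walk and its expected cover time *)

Section Walk.
Variables (R : realType) (d : measure_display) (Omega : measurableType d).
Variables (P : probability Omega R) (V : finType) (e : rel V) (s : V).
Variables (X : nat -> Omega -> V) (X_srw : simple_random_walk P e s X).

Lemma measurable_walk_event (Q : nat -> pred V) :
  measurable [set w | forall i, Q i (X i w)]%classic.
Proof.
rewrite (_ : [set w | _] = \bigcap_i [set w | Q i (X i w)])%classic.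
  apply: bigcapT_measurable => i.
  rewrite (_ : [set w | _] =
      \bigcup_(x in [set x | Q i x]) [set w | X i w = x])%classic.
    apply: fin_bigcup_measurable => [|x _]; first exact: finite_finset.
    exact: srw_measurable X_srw i x.
  by apply/seteqP; split=> w /= => [Qw|[x Qx ->]//]; exists (X i w).
by apply/seteqP; split=> w => [Qw i _|Qw i]; exact: Qw.
Qed.

Definition cylinder (k : nat) (x : nat -> V) : set Omega :=
  [set w | forall i, (i <= k)%N -> X i w = x i]%classic.

(** The window starts at an arbitrary time [k] so that an induction on [m] can advance its left
    end. *)
Definition staying (B : {set V}) (k m : nat) : set Omega :=
  [set w | forall i, (k <= i <= k + m)%N -> X i w \in B]%classic.

Lemma measurable_cylinder k x : measurable (cylinder k x).
Proof.
rewrite (_ : cylinder k x =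
    [set w | forall i, (i <= k)%N ==> (X i w == x i)]%classic).
  exact: (measurable_walk_event (fun i y => (i <= k)%N ==> (y == x i))).
apply/seteqP; split=> w Hw i; first by apply/implyP => /Hw ->.
by move=> ik; apply/eqP; move: (Hw i); rewrite ik.
Qed.

Lemma measurable_staying B k m : measurable (staying B k m).
Proof.
rewrite (_ : staying B k m =
    [set w | forall i, (k <= i <= k + m)%N ==> (X i w \in B)]%classic).
  exact: (measurable_walk_event (fun i y => (k <= i <= k + m)%N ==> (y \in B))).
by apply/seteqP; split=> w Hw i; [apply/implyP; exact: Hw | exact/implyP].
Qed.

(** A Markov property. Splitting on the value of the walk at time [k.+1] lengthens the cylinder by
    one step and shortens the window by one; [srw_step] supplies the transition factor. *)
Lemma cylinder_staying (B : {set V}) k m x :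
  fine (P (cylinder k x `&` staying B k m)%classic) =
  fine (P (cylinder k x)) * survival R e B m (x k).
Proof.
elim: m k x => [|m IH] k x.
  rewrite /survival /=; have [xB|xB] := boolP (x k \in B).
    rewrite mulr1; congr (fine (P _)); apply/seteqP; split=> w; first by case.
    move=> Hw; split=> // i; rewrite addn0 -eqn_leq => /eqP <-.
    by rewrite Hw.
  rewrite mulr0 (_ : (_ `&` _)%classic = set0) ?measure0 //.
  apply/seteqP; split=> w //= [/(_ k (leqnn _)) Xk /(_ k)].
  by rewrite addn0 leqnn Xk (negPf xB) => /(_ isT).
have mA : measurable (cylinder k x `&` staying B k m.+1)%classic.
  by apply: measurableI; [exact: measurable_cylinder|exact: measurable_staying].
rewrite (fine_probability_partition P mA (srw_measurable X_srw k.+1)).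
rewrite /survival iterS -/(survival R e B m) /killed_step !mulr_sumr.
apply: eq_bigr => z _.
(* The prescribed path is continued by [z]; only its value at time [k.+1] matters for the longer
   cylinder. *)
pose x' i := if (i <= k)%N then x i else z.
have x'k : x' k.+1 = z by rewrite /x' ltnn.
have x'E i : (i <= k)%N -> x' i = x i by rewrite /x' => ->.
have step : fine (P (cylinder k.+1 x')) =
    fine (P (cylinder k x)) * step_prob R e (x k) z.
  apply: EFin_inj; rewrite EFinM -!probability_EFin; try exact: measurable_cylinder.
  rewrite /cylinder (srw_step X_srw) x'k x'E //; congr (P _ * _)%E.
  by apply/seteqP; split=> w Hw i ik; rewrite Hw // x'E.
have [xB|xB] := boolP (x k \in B); last first.
  rewrite mul0r mulr0 (_ : (_ `&` _)%classic = set0) ?measure0 //.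
  apply/seteqP; split=> w //= [[/(_ k (leqnn _)) Xk /(_ k)]].
  by rewrite leqnn leq_addr Xk (negPf xB) => /(_ isT).
rewrite mul1r mulrA -step -[in X in survival _ _ _ _ X]x'k -IH.
congr (fine (P _)); apply/seteqP; split=> w /=.
  move=> [[Hx HB] Hz]; split=> i.
    by rewrite leq_eqVlt => /orP[/eqP -> //|ik]; [rewrite Hz x'k | rewrite Hx // x'E].
  move=> /andP[ki im]; apply: HB; rewrite addnS -addSn im andbT; exact: ltnW.
move=> [Hx HB]; split; last by rewrite Hx // x'k.
have Hk i : (i <= k)%N -> X i w = x i by move=> ik; rewrite Hx ?x'E // leqW.
split=> // i /andP[]; rewrite leq_eqVlt => /orP[/eqP <- _|ki im]; first by rewrite Hk.
by apply: HB; rewrite ki addSn -addnS im.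
Qed.

(** The start at [s] is only almost sure, so the event is split by the initial vertex, and every
    part with another initial vertex is null. *)
Lemma walk_staying (B : {set V}) t :
  fine (P (staying B 0 t)) = survival R e B t s.
Proof.
have P0 : P [set w | X 0%N w = s]%classic = 1%E := srw_start X_srw.
have cyl0 : cylinder 0 (fun=> s) = [set w | X 0%N w = s]%classic.
  apply/seteqP; split=> w; first by move/(_ 0%N (leqnn _)).
  by move=> Xw i; rewrite leqn0 => /eqP ->.
have mS := measurable_staying B 0 t.
rewrite (fine_probability_partition P mS (srw_measurable X_srw 0)) (bigD1 s) //=.
rewrite -cyl0 setIC cylinder_staying cyl0 P0 mul1r big1 ?addr0 // => z zs.
have mz : measurable [set w | X 0%N w = z]%classic by exact: srw_measurable X_srw _ _.
have ms : measurable [set w | X 0%N w = s]%classic by exact: srw_measurable X_srw _ _.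
suff -> : P (staying B 0 t `&` [set w | X 0%N w = z])%classic = 0%E by [].
apply/eqP; rewrite eq_le measure_ge0 andbT.
have <- : P (~` [set w | X 0%N w = s])%classic = 0%E.
  by rewrite probability_setC // P0 subee.
apply: le_measure; rewrite ?inE; first exact: measurableI.
  exact: measurableC.
by move=> w [_ /= ->]; apply/eqP.
Qed.

Definition unvisited (t : nat) (w : Omega) : {set V} :=
  [set x | [forall i : 'I_t.+1, X i w != x]]%SET.

Lemma subset_unvisited (S : {set V}) t :
  [set w | S \subset unvisited t w]%classic = staying (~: S)%SET 0 t.
Proof.
apply/seteqP; split=> w /=.
  move/fintype.subsetP => Sw i /= it; rewrite inE; apply/negP => /Sw.
  by rewrite inE => /forallP/(_ (Ordinal (it : (i < t.+1)%N))); rewrite eqxx.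
move=> Hw; apply/fintype.subsetP => x xS; rewrite inE; apply/forallP => i.
apply: contraL xS => /eqP <-; have := Hw i (ltn_ord i).
by rewrite inE.
Qed.

Lemma measurable_unvisited t S : measurable [set w | unvisited t w = S]%classic.
Proof.
have mx x : measurable [set w | x \in unvisited t w]%classic.
  (* Membership of [x] is the singleton case of [subset_unvisited], hence a staying event. *)
  under eq_set do rewrite -finset.sub1set.
  by rewrite subset_unvisited; exact: measurable_staying.
rewrite (_ : [set w | _]%classic = (\bigcap_(x in [set: V])
    (if x \in S then [set w | x \in unvisited t w]
     else ~` [set w | x \in unvisited t w]))%classic); last first.
  apply/seteqP; split=> w /=.
    by move=> <- x _; case: ifP => //= /negbT/negP.
  move=> Hw; apply/setP => x; have := Hw x I.
  by case: (x \in S) => //= /negP/negbTE.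
apply: fin_bigcap_measurable => [|x _]; first exact: finite_finset.
by case: ifP => // _; exact: measurableC.
Qed.

Definition uncovered (t : nat) : set Omega :=
  [set w | unvisited t w != finset.set0]%classic.

Lemma measurable_uncovered t : measurable (uncovered t).
Proof.
rewrite (_ : uncovered t = ~` [set w | unvisited t w = finset.set0])%classic.
  exact/measurableC/measurable_unvisited.
by apply/seteqP; split=> w /= /eqP.
Qed.

Lemma unvisitedP t w :
  (forall x : V, exists2 k, (k <= t)%N & X k w = x) <-> unvisited t w = finset.set0.
Proof.
split=> [Hw|Hw x].
  apply/setP => x; rewrite !inE; apply/negbTE/forallPn.
  by have [k kt <-] := Hw x; exists (Ordinal (kt : (k < t.+1)%N)); rewrite negbK.
have : x \notin unvisited t w by rewrite Hw inE.
rewrite inE => /forallPn[i]; rewrite negbK => /eqP Xi.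
by exists i => //; have := ltn_ord i; rewrite ltnS.
Qed.

(** Since unvisited sets shrink with time, a walk first covering at time [T] is uncovered exactly at
    the [T] times below [T]. *)
Lemma cover_time_series w :
  cover_time R X w = (\sum_(0 <= t <oo) (\1_(uncovered t) w)%:E)%E.
Proof.
have mono t t' : (t <= t')%N -> unvisited t w = finset.set0 ->
    unvisited t' w = finset.set0.
  move=> tt' /unvisitedP Hw; apply/unvisitedP => x.
  by have [k kt Xk] := Hw x; exists k => //; apply: leq_trans tt'.
have ge0 t : (0 <= (\1_(uncovered t) w)%:E :> \bar R)%E by rewrite lee_fin.
have [[T0 HT0]|noT] := pselect (exists t, unvisited t w == finset.set0).
  have exT : exists t, unvisited t w == finset.set0 by exists T0.
  case: (ex_minnP exT) => T /eqP HT Tmin.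
  rewrite (nneseries_split 0 T) // eseries0 ?adde0 => [|t]; last first.
    rewrite add0n => Tt _; rewrite indicE memNset //= /uncovered /=.
    by rewrite (mono _ _ Tt HT) eqxx.
  transitivity (T%:R%:E : \bar R).
    apply/eqP; rewrite eq_le; apply/andP; split.
      apply: ereal_inf_lbound; exists T => //; exact/unvisitedP.
    apply: le_ereal_inf_tmp => _ [t /unvisitedP/eqP /Tmin Tt <-].
    by rewrite lee_fin ler_nat.
  rewrite add0n (eq_big_nat _ _ (F2 := fun=> 1%:E)) => [|t /andP[_ tT]].
    by rewrite sumEFin big_const_nat subn0 iter_addr_0.
  rewrite indicE mem_set //=; apply: contraTN tT => /Tmin.
  by rewrite -leqNgt.
(* If the walk never covers, the infimum is over the empty set, hence infinite, and every indicator
   in the series is 1. *)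
rewrite /cover_time (_ : [set _ | _ in _]%classic = set0) ?ereal_inf0; last first.
  apply/seteqP; split=> y //= [t /unvisitedP Ht _].
  by case: noT; exists t; apply/eqP.
apply/esym/eq_infty => r.
(* This many terms, each equal to 1, already sum to more than [r]. *)
apply: le_trans (nneseries_lim_ge (Num.truncn `|r|).+1 (fun t _ _ => ge0 t)).
rewrite (eq_big_nat _ _ (F2 := fun=> 1%:E)) => [|t _]; last first.
  by rewrite indicE mem_set //=; apply/negP => Ht; apply: noT; exists t.
rewrite sumEFin big_const_nat subn0 iter_addr_0 lee_fin.
by apply: le_trans (ler_norm _) _; rewrite ltW // truncnS_gt.
Qed.

Lemma survival_notin (B : {set V}) t x : x \notin B -> survival R e B t x = 0.
Proof.
move=> /negbTE xB.
by case: t => [|t]; rewrite /survival /= ?/killed_step xB ?mul0r.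
Qed.

(** Sets [S] containing [s] drop out of the inclusion-exclusion sum: the walk starts outside their
    complement, so the survival probability is 0. *)
Lemma probability_uncovered t : fine (P (uncovered t)) =
  \sum_(S in nonempty_subsets_avoiding s)
    (-1) ^+ #|S|.+1 * survival R e (~: S)%SET t s.
Proof.
rewrite probability_nonempty; last exact: measurable_unvisited.
rewrite (bigID (fun S : {set V} => S \subset [set~ s]%SET)) /= addrC big1 => [|S].
  rewrite add0r; apply: eq_big => [S|S _]; first by rewrite inE.
  by rewrite subset_unvisited walk_staying.
move=> /andP[_ Ss]; rewrite subset_unvisited walk_staying survival_notin ?mulr0 //.
rewrite inE negbK; apply: contraR Ss => sS; apply/fintype.subsetP => x xS.
by rewrite !inE; apply: contraNneq sS => <-.
Qed.

Lemma expected_cover_timeE :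
  symmetric e -> connected_graph e ->
  expected_cover_time P X =
  (\sum_(S in nonempty_subsets_avoiding s)
    (-1) ^+ #|S|.+1 * exit_time R e (~: S)%SET s)%:E.
Proof.
move=> e_sym e_conn; rewrite /expected_cover_time.
under eq_integral do rewrite cover_time_series.
(* The indicators are nonnegative and measurable, so the integral passes through the series. *)
rewrite integral_nneseries //; first last.
- by move=> t; apply/measurable_realfun.measurable_EFinP/measurable_realfun.measurable_indic/measurable_uncovered.
have PE t : (\int[P]_w (\1_(uncovered t) w)%:E)%E =
    (\sum_(S in nonempty_subsets_avoiding s)
      (-1) ^+ #|S|.+1 * survival R e (~: S)%SET t s)%:E.
  rewrite integral_indic //; last exact: measurable_uncovered.
  rewrite setIT -probability_uncovered.
  by apply: probability_EFin; exact: measurable_uncovered.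
rewrite (eq_eseriesr (fun t _ => PE t)).
apply: cvg_lim => //; under eq_fun do rewrite sumEFin.
apply: cvg_EFin; first exact: nearW.
rewrite /=; under eq_fun do rewrite exchange_big /=.
(* The sum over [S] is finite, so limits are taken one [S] at a time; an element of the nonempty [S]
   is the vertex outside [B] that [survival_series_cvg] needs. *)
apply: cvg_big => [|S]; first exact: add_continuous.
rewrite inE => /andP[/set0Pn[x0 x0S] _].
under eq_fun do rewrite -mulr_sumr.
apply: cvgMr; apply: (@survival_series_cvg _ _ _ _ x0) => //.
by rewrite inE x0S.
Qed.

End Walk.

Lemma card_nonempty_subsets_avoiding (V : finType) (s : V) :
  #|nonempty_subsets_avoiding s| = (2 ^ (#|V| - 1) - 1)%N.
Proof.
have -> : nonempty_subsets_avoiding s =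
    (powerset [set~ s] :\ finset.set0)%SET.
  by apply/setP => S; rewrite !inE.
have := cardsD1 finset.set0 (powerset [set~ s]%SET).
rewrite card_powerset cardsC1 !inE finset.sub0set add1n !subn1.
by move=> ->.
Qed.

Theorem theorem2p3 (R : realType) (V : finType) (e : rel V)
    (e_sym : symmetric e) (e_irr : irreflexive e)
    (e_conn : connected_graph e)
    (u v s : V) (uv_neq : u != v) (uv_nonadj : ~~ e u v)
    (d : measure_display) (Omega : measurableType d)
    (P : probability Omega R) (X : nat -> Omega -> V)
    (X_srw : simple_random_walk P e s X)
    (d' : measure_display) (Omega' : measurableType d')
    (P' : probability Omega' R) (X' : nat -> Omega' -> V)
    (X'_srw : simple_random_walk P' (add_edge e u v) s X') :
  (expected_cover_time P' X' - expected_cover_time P X)%E =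
    (\sum_(S in nonempty_subsets_avoiding s)
        (-1) ^+ #|S|.+1 * F_term R e u v s S)%:E
  /\ #|nonempty_subsets_avoiding s| = (2 ^ (#|V| - 1) - 1)%N.
Proof.
split; last exact: card_nonempty_subsets_avoiding.
rewrite (expected_cover_timeE X_srw e_sym e_conn).
rewrite (expected_cover_timeE X'_srw (add_edge_sym u v e_sym)
  (add_edge_connected u v e_conn)).
(* Both expectations are now finite, so the extended-real difference is a real one and can be
   compared term by term. *)
rewrite -EFinB -sumrB; congr EFin; apply: eq_bigr => S HS.
by rewrite F_term_exit_time // mulrBr.
Qed.
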